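(* Let $p$ be a prime and $1\leq r\leq p$. Let $\psi:\mathbb{Z}_p\to\mathbb{Z}_p$ be a function for which there exist $A_1,\ldots,A_{r-1}\in\mathbb{Z}_p$ such that $$\psi(tp)\equiv\psi(0)+\sum_{k=1}^{r-1}\frac{A_k}{k!}(tp)^k\pmod{p^r}\quad\text{for all }t\in\mathbb{Z}_p.$$ Let $a_1,\ldots,a_r\in\mathbb{Z}_p$ with $a_i\not\equiv a_j\pmod p$ for all $1\leq i<j\leq r$, and suppose $\psi(a_ip)\equiv0\pmod{p^r}$ for each $1\leq i\leq r$. Then $\psi(sp)\equiv0\pmod{p^r}$ for every $s\in\mathbb{Z}_p$, and $A_k\equiv0\pmod{p^{r-k}}$ for each $1\leq k\leq r-1$.
   Context: $\mathbb{Z}_p$ denotes the ring of $p$-adic integers. *)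

(* Defs.v *)
From HB Require Import structures.
From mathcomp Require Import all_boot all_order all_algebra.
From mathcomp Require Import boolp.

Set Implicit Arguments.
Unset Strict Implicit.
Unset Printing Implicit Defensive.

Import GRing.Theory.
Local Open Scope ring_scope.

(* Z_p is built as the inverse limit of the rings Z/p^n: an element is a      *)
(* sequence of integers whose n-th term is the representative in [0, p^n) of  *)
(* a class mod p^n.  Both the range condition and the compatibility of        *)
(* consecutive terms are contained in x n = x (n+1) %% p^n.                   *)
Definition padic_coherent (p : nat) (x : nat -> int) : bool :=
  `[< forall n, x n = (x n.+1 %% (p ^ n)%:Z)%Z >].

(* The primality proof is an argument so that the ring instances below apply. *)
Record padic_int (p : nat) (p_pr : prime p) := PadicInt {
  padic_seq :> nat -> int;
  _ : padic_coherent p padic_seq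
}.

HB.instance Definition _ (p : nat) (p_pr : prime p) :=
  [isSub for @padic_seq p p_pr].
HB.instance Definition _ (p : nat) (p_pr : prime p) :=
  [Choice of padic_int p_pr by <:].

Section PadicRing.
Variables (p : nat) (p_pr : prime p).
Implicit Types (x y z : padic_int p_pr) (n : nat).

Lemma padicP x y : (forall n, x n = y n) -> x = y.
Proof. by move=> xy; apply: val_inj; apply/funext. Qed.

Lemma padic_seqS x n : x n = (x n.+1 %% (p ^ n)%:Z)%Z.
Proof. by case: x => x xP; exact: (asboolW xP). Qed.

Lemma padic_seq_mod x n : (x n %% (p ^ n)%:Z)%Z = x n.
Proof. by rewrite [in LHS]padic_seqS modz_mod -padic_seqS. Qed.

Lemma modz_expnS (a : int) n :
  ((a %% (p ^ n.+1)%:Z)%Z %% (p ^ n)%:Z)%Z = (a %% (p ^ n)%:Z)%Z.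
Proof.
by rewrite expnS [in RHS](divz_eq a (p * p ^ n)%N) PoszM mulrA modzMDl.
Qed.

Lemma padic_reduce_subproof (f : nat -> int) :
  (forall n, (f n = f n.+1 %[mod (p ^ n)%:Z])%Z) ->
  padic_coherent p (fun n => (f n %% (p ^ n)%:Z)%Z).
Proof. by move=> fE; apply/asboolP => n; rewrite modz_expnS fE. Qed.

Definition padic_reduce (f : nat -> int)
    (fE : forall n, (f n = f n.+1 %[mod (p ^ n)%:Z])%Z) : padic_int p_pr :=
  PadicInt p_pr (padic_reduce_subproof fE).

Lemma padic_const_subproof (a : int) n : (a = a %[mod (p ^ n)%:Z])%Z.
Proof. by []. Qed.

Lemma padic_opp_subproof x n : (- x n = - x n.+1 %[mod (p ^ n)%:Z])%Z.
Proof. by rewrite [x n]padic_seqS modzNm. Qed.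

Lemma padic_add_subproof x y n :
  (x n + y n = x n.+1 + y n.+1 %[mod (p ^ n)%:Z])%Z.
Proof. by rewrite [x n]padic_seqS [y n]padic_seqS modzDm. Qed.

Lemma padic_mul_subproof x y n :
  (x n * y n = x n.+1 * y n.+1 %[mod (p ^ n)%:Z])%Z.
Proof. by rewrite [x n]padic_seqS [y n]padic_seqS modzMm. Qed.

Definition padic_zero := padic_reduce (padic_const_subproof 0).
Definition padic_one := padic_reduce (padic_const_subproof 1).
Definition padic_opp x := padic_reduce (padic_opp_subproof x).
Definition padic_add x y := padic_reduce (padic_add_subproof x y).
Definition padic_mul x y := padic_reduce (padic_mul_subproof x y).

Lemma padic_addA : associative padic_add.
Proof. by move=> x y z; apply: padicP => n /=; rewrite modzDmr modzDml addrA. Qed.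

Lemma padic_addC : commutative padic_add.
Proof. by move=> x y; apply: padicP => n /=; rewrite addrC. Qed.

Lemma padic_add0 : left_id padic_zero padic_add.
Proof.
by move=> x; apply: padicP => n /=; rewrite modzDml add0r padic_seq_mod.
Qed.

Lemma padic_addN : left_inverse padic_zero padic_opp padic_add.
Proof. by move=> x; apply: padicP => n /=; rewrite modzDml addNr. Qed.

HB.instance Definition _ := GRing.isZmodule.Build (padic_int p_pr)
  padic_addA padic_addC padic_add0 padic_addN.

Lemma padic_mulA : associative padic_mul.
Proof. by move=> x y z; apply: padicP => n /=; rewrite modzMmr modzMml mulrA. Qed.

Lemma padic_mulC : commutative padic_mul.
Proof. by move=> x y; apply: padicP => n /=; rewrite mulrC. Qed.

Lemma padic_mul1 : left_id padic_one padic_mul.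
Proof.
by move=> x; apply: padicP => n /=; rewrite modzMml mul1r padic_seq_mod.
Qed.

Lemma padic_mulD : left_distributive padic_mul padic_add.
Proof.
by move=> x y z; apply: padicP => n /=; rewrite modzMml mulrDl modzDm.
Qed.

Lemma padic_one_neq0 : padic_one != 0.
Proof.
apply/eqP => /(congr1 (fun x : padic_int p_pr => x 1%N)) /=.
by rewrite expn1 mod0z modz_small //= ltz_nat prime_gt1.
Qed.

HB.instance Definition _ := GRing.Zmodule_isComNzRing.Build (padic_int p_pr)
  padic_mulA padic_mulC padic_mul1 padic_mulD padic_one_neq0.

Definition padic_unit : pred (padic_int p_pr) :=
  fun x => `[< exists y : padic_int p_pr, y * x = 1 >].

Definition padic_inv x : padic_int p_pr :=
  if pselect (exists y : padic_int p_pr, y * x = 1) is left ex_y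
  then projT1 (cid ex_y) else x.

Lemma padic_mulV : {in padic_unit, left_inverse 1 padic_inv *%R}.
Proof.
move=> x /asboolP ex_y; rewrite /padic_inv.
by case: pselect => // ex_y'; case: cid.
Qed.

Lemma padic_unitPl x y : y * x = 1 -> padic_unit x.
Proof. by move=> yx; apply/asboolP; exists y. Qed.

Lemma padic_inv_out : {in [predC padic_unit], padic_inv =1 id}.
Proof.
by move=> x /asboolPn nex_y; rewrite /padic_inv; case: pselect.
Qed.

HB.instance Definition _ := GRing.ComNzRing_hasMulInverse.Build (padic_int p_pr)
  padic_mulV padic_unitPl padic_inv_out.

Lemma padic_natE (m n : nat) :
  (m%:R : padic_int p_pr) n = (m%:Z %% (p ^ n)%:Z)%Z.
Proof.
elim: m => [|m IHm] //; rewrite mulrS.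
change (((1%:Z %% (p ^ n)%:Z)%Z + (m%:R : padic_int p_pr) n) %% (p ^ n)%:Z)%Z
  with ((1%:R + m%:R : padic_int p_pr) n).
by rewrite /= IHm modzDm -PoszD add1n.
Qed.

Lemma padic_inv_nat_subproof (m : nat) : coprime m p ->
  forall n, ((egcdz m%:Z (p ^ n)%:Z).1 =
             (egcdz m%:Z (p ^ n.+1)%:Z).1 %[mod (p ^ n)%:Z])%Z.
Proof.
move=> mp n; have bez k : (exists c,
    (egcdz m%:Z (p ^ k)%:Z).1 * m%:Z = 1 + c * (p ^ k)%:Z)%Z.
  case: egcdzP => u v /= uv _; exists (- v).
  have g1 : gcdz m (p ^ k)%N = 1.
    by apply/eqP; rewrite /gcdz eqz_nat /= -/(coprime _ _) coprimeXr.
  by rewrite g1 in uv; rewrite -uv mulNr addrK.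
have [c0 e0] := bez n; have [c1 e1] := bez n.+1.
apply/eqP; rewrite eqz_mod_dvd -(@Gauss_dvdzl _ _ m%:Z); last first.
  by rewrite coprimez_sym /coprimez /gcdz eqz_nat /= -/(coprime _ _) coprimeXr.
rewrite mulrBl e0 e1 expnS PoszM.
apply/dvdzP; exists (c0 - c1 * p%:Z).
by rewrite opprD addrACA subrr add0r mulrBl mulrA.
Qed.

Lemma padic_nat_unit (m : nat) :
  coprime m p -> (m%:R : padic_int p_pr) \is a GRing.unit.
Proof.
move=> mp; apply/unitrPr.
exists (padic_reduce (padic_inv_nat_subproof mp)).
apply: padicP => n; rewrite [LHS]/= padic_natE modzMm mulrC.
case: egcdzP => u v /= uv _.
have g1 : gcdz m (p ^ n)%N = 1.
  by apply/eqP; rewrite /gcdz eqz_nat /= -/(coprime _ _) coprimeXr.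
by rewrite g1 in uv; rewrite -uv addrC modzMDl.
Qed.

(* Hence x / (k`!)%:R is a genuine quotient for k < p. *)
Lemma padic_fact_unit (k : nat) :
  (k < p)%N -> ((k`!)%:R : padic_int p_pr) \is a GRing.unit.
Proof.
move=> kp; apply: padic_nat_unit; rewrite coprime_sym prime_coprime //.
elim: k kp => [|k IHk] kp; first by rewrite fact0 Euclid_dvd1.
rewrite factS Euclid_dvdM // negb_or IHk ?andbT; last exact: ltnW.
by rewrite gtnNdvd.
Qed.

End PadicRing.

Definition congr_mod (R : comNzRingType) (m x y : R) : Prop :=
  exists z : R, x - y = z * m.

Notation "x ≡ y '[mod' m ]" := (congr_mod m x y)
  (at level 70, y at next level, m at level 200,
   format "x  ≡  y  [mod  m ]") : ring_scope.

(* Main.v *)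
(* Modulo p^r the function t |-> psi (t p) is a polynomial of degree < r whose
   k-th coefficient is p^k A_k / k!.  It vanishes mod p^r at r points with
   pairwise differences invertible mod p^r, so dividing out these roots one at a
   time shows that all its coefficients vanish mod p^r.  This gives the
   first claim at once, and the second since k! is a unit for k < p and p is not
   a zero divisor. *)
Require Import Defs.
From HB Require Import structures.
From mathcomp Require Import all_boot all_order all_algebra.

Set Implicit Arguments.
Unset Strict Implicit.
Unset Printing Implicit Defensive.

Import GRing.Theory.
Local Open Scope ring_scope.

Section Congruences.
Variables (R : comNzRingType) (m : R).
Implicit Types x y z : R.

Lemma congr_mod0P x : x ≡ 0 [mod m] <-> exists z, x = z * m.
Proof. by rewrite /congr_mod subr0. Qed.

Lemma congr_mod_sub0 x y : x ≡ y [mod m] <-> x - y ≡ 0 [mod m].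
Proof. by rewrite congr_mod0P. Qed.

Lemma congr_mod0D x y : x ≡ 0 [mod m] -> y ≡ 0 [mod m] -> x + y ≡ 0 [mod m].
Proof.
rewrite !congr_mod0P => -[u ->] [v ->].
by exists (u + v); rewrite mulrDl.
Qed.

Lemma congr_mod0Ml x y : y ≡ 0 [mod m] -> x * y ≡ 0 [mod m].
Proof. by rewrite !congr_mod0P => -[u ->]; exists (x * u); rewrite mulrA. Qed.

Lemma congr_mod0Mr x y : x ≡ 0 [mod m] -> x * y ≡ 0 [mod m].
Proof. by rewrite mulrC; apply: congr_mod0Ml. Qed.

Lemma congr_mod0N x : x ≡ 0 [mod m] -> - x ≡ 0 [mod m].
Proof. by rewrite -mulN1r; apply: congr_mod0Ml. Qed.

Lemma congr_mod0B x y : x ≡ 0 [mod m] -> y ≡ 0 [mod m] -> x - y ≡ 0 [mod m].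
Proof. by move=> x0 /congr_mod0N; apply: congr_mod0D. Qed.

Lemma congr_mod0_eq x y : x ≡ y [mod m] -> x ≡ 0 [mod m] <-> y ≡ 0 [mod m].
Proof.
rewrite congr_mod_sub0 => xy0; split=> [x0|y0].
  by rewrite -[y](subKr x); apply: congr_mod0B.
by rewrite -(subrK y x); apply: congr_mod0D.
Qed.

(** Invertibility of [u] modulo [m] is enough here; [u] need not be a unit of [R]. *)
Lemma congr_mod0_cancel u v x :
  v * u ≡ 1 [mod m] -> u * x ≡ 0 [mod m] -> x ≡ 0 [mod m].
Proof.
move=> /congr_mod_sub0 vu1 ux0.
have -> : x = v * (u * x) - (v * u - 1) * x.
  by rewrite mulrBl mul1r mulrA subKr.
by apply: congr_mod0B; [apply: congr_mod0Ml | apply: congr_mod0Mr].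
Qed.

(** [R] modulo [m] may have zero divisors, so counting roots is replaced by induction on [n]: the
    last point [c n] is divided out, and the quotient still vanishes mod [m] at each earlier [c i]
    because [c i - c n] is invertible there. *)
Lemma congr_poly_coef0 n (f : {poly R}) (c : nat -> R) :
  (forall i j, (i < j < n)%N -> exists v, v * (c i - c j) ≡ 1 [mod m]) ->
  (size f <= n)%N -> (forall i, (i < n)%N -> f.[c i] ≡ 0 [mod m]) ->
  forall k, f`_k ≡ 0 [mod m].
Proof.
elim: n f => [|n IHn] f c_inv szf f0 k.
  move: szf; rewrite leqn0 size_poly_eq0 => /eqP ->.
  by rewrite coef0 congr_mod0P; exists 0; rewrite mul0r.
(* [c n] is a root of [f] only mod [m]; subtracting the value [f.[c n]] makes it an exact root. *)
have [q fE] : exists q, f - (f.[c n])%:P = q * ('X - (c n)%:P).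
  by apply/factor_theorem; rewrite rootE !hornerE subrr.
have szq : (size q <= n)%N.
  have [->|q0] := eqVneq q 0; first by rewrite size_poly0.
  have : (size (f - (f.[c n])%:P)%R <= n.+1)%N.
    rewrite (leq_trans (size_polyD _ _)) // geq_max szf size_polyN.
    exact: leq_trans (size_polyC_leq1 _) _.
  by rewrite fE size_Mmonic ?monicXsubC // size_XsubC addn2.
have q0 : forall l, q`_l ≡ 0 [mod m].
  apply: IHn => // [i j /andP[ij jn]|i lt_in].
    by apply: c_inv; rewrite ij ltnW.
  have [v cv] := c_inv i n ltac:(by rewrite lt_in leqnn).
  apply: (congr_mod0_cancel cv).
  have -> : (c i - c n) * q.[c i] = f.[c i] - f.[c n].
    by move/(congr1 (horner^~ (c i))): fE; rewrite !hornerE mulrC => <-.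
  by apply: congr_mod0B; apply: f0; rewrite // ltnW.
(* Coefficients are read off from [f = q * 'X - q * (c n)%:P + (f.[c n])%:P], each summand being 0
   mod [m]. *)
rewrite -(subrK (f.[c n])%:P f) fE coefD mulrBr coefB coefMX coefMC coefC.
have z0 : 0 ≡ 0 [mod m] by rewrite congr_mod0P; exists 0; rewrite mul0r.
apply: congr_mod0D; last by case: ifP => _ //; apply: f0.
by apply: congr_mod0B; [case: ifP | apply: congr_mod0Mr].
Qed.

(* A truncated geometric series lifts an inverse mod m to an inverse mod m^r. *)
Lemma congr_inv_exp (u v : R) r :
  v * u ≡ 1 [mod m] -> exists w, w * u ≡ 1 [mod m ^+ r].
Proof.
case=> z vuE; exists (v * \sum_(i < r) (1 - v * u) ^+ i), (- (- z) ^+ r).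
rewrite mulNr -exprMn mulNr -vuE opprB mulrAC.
have := subrX1 (1 - v * u) r; set S := \sum_(i < r) _.
rewrite [1 - v * u - 1]addrAC subrr sub0r mulNr => xr1.
by rewrite -[v * u * S]opprK -xr1 opprB addrAC subrr sub0r.
Qed.

End Congruences.

Section PadicDivisibility.
Variables (p : nat) (p_pr : prime p).
Implicit Types x y : padic_int p_pr.

Lemma padic_seq_le x n k : (n <= k)%N -> (x k %% (p ^ n)%:Z)%Z = x n.
Proof.
elim: k => [|k IHk]; first by rewrite leqn0 => /eqP->; apply: padic_seq_mod.
rewrite leq_eqVlt => /predU1P[->|lenk]; first exact: padic_seq_mod.
rewrite -(IHk lenk) (padic_seqS x k) -(subnK (n:=k) (m:=n) lenk) expnD PoszM.
set P := (p ^ (k - n))%N%:Z.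
by rewrite [in LHS](divz_eq (x _) (P * (p ^ n)%N%:Z)) mulrA modzMDl.
Qed.

Lemma padic_mulnE x n : (x * p%:R) n = (x n * p%:Z %% (p ^ n)%:Z)%Z.
Proof. by rewrite [LHS]/= padic_natE modzMmr. Qed.

Let pn0 : p%:Z != 0.
Proof. by rewrite eqz_nat -lt0n prime_gt0. Qed.

(** Cancelling [p] costs one level of precision: if [p ^ n.+1] divides [x n.+1 * p], then [p ^ n]
    divides [x n.+1], whose residue mod [p ^ n] is [x n]. *)
Lemma padic_mulIp : injective (fun x => x * p%:R).
Proof.
suff p_reg x : x * p%:R = 0 -> x = 0.
  move=> x y /= /eqP; rewrite -subr_eq0 -mulrBl => /eqP /p_reg /eqP.
  by rewrite subr_eq0 => /eqP.
move=> /(congr1 (@padic_seq p p_pr)) x0; apply: padicP => n.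
have := congr1 (@^~ n.+1) x0; rewrite padic_mulnE /= mod0z => /dvdz_mod0P.
by rewrite expnSr PoszM dvdz_mul2r // => /dvdz_mod0P; rewrite -padic_seqS mod0z.
Qed.

Lemma padic_mulIpexp k : injective (fun x => x * p%:R ^+ k).
Proof.
elim: k => [|k IHk] x y /=; first by rewrite expr0 !mulr1.
by rewrite exprSr !mulrA => /padic_mulIp /IHk.
Qed.

(** The quotient by [p] is the sequence [x n.+1 %/ p]: the shift makes up for the level lost in the
    division, so that it is still coherent mod [p ^ n]. *)
Lemma congr_mod_p0 x : x 1%N = 0 -> x ≡ 0 [mod p%:R].
Proof.
move=> x10; apply/congr_mod0P.
have dvd n : (p%:Z %| x n.+1)%Z.
  by apply/dvdz_mod0P; rewrite -[X in (X)%:Z]expn1 padic_seq_le.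
have zE n : ((x n.+1 %/ p)%Z = (x n.+2 %/ p)%Z %[mod (p ^ n)%:Z])%Z.
  apply/eqP; rewrite eqz_mod_dvd -(dvdz_mul2r pn0) mulrBl !divzK //.
  by rewrite -PoszM -expnSr -eqz_mod_dvd padic_seq_mod -padic_seqS.
exists (padic_reduce p_pr zE); apply: padicP => n.
by rewrite padic_mulnE /= modzMml divzK // -padic_seqS.
Qed.

Lemma padic_congr_nat x : x ≡ (`|x 1%N|%N)%:R [mod p%:R].
Proof.
apply/congr_mod_sub0/congr_mod_p0 => /=; rewrite padic_natE.
have x1 : (`|x 1%N|%N)%:Z = x 1%N.
  by rewrite gez0_abs // -padic_seq_mod modz_ge0 // expn1.
by rewrite x1 padic_seq_mod modzDmr subrr mod0z.
Qed.

(** The natural number representing [x] mod [p] is prime to [p], hence a unit of the p-adic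
    integers, and its inverse also inverts [x] mod [p]. *)
Lemma padic_inv_mod_p x :
  ~ (x ≡ 0 [mod p%:R]) -> exists v, v * x ≡ 1 [mod p%:R].
Proof.
move=> x_nz; have [z xE] := padic_congr_nat x.
set m := `|x 1%N|%N in xE.
have m_unit : (m%:R : padic_int p_pr) \is a GRing.unit.
  apply: padic_nat_unit; rewrite coprime_sym prime_coprime //.
  apply/negP => /dvdnP[q mE]; apply: x_nz; apply/congr_mod0P.
  by exists (z + q%:R); rewrite mulrDl -natrM -mE -xE subrK.
exists m%:R^-1, (m%:R^-1 * z).
by rewrite -mulrA -xE mulrBr mulVr.
Qed.

End PadicDivisibility.

Theorem theorem2p1 (p : nat) (p_pr : prime p) (r : nat)
    (hr : (1 <= r <= p)%N)
    (psi : padic_int p_pr -> padic_int p_pr)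
    (A : nat -> padic_int p_pr)
    (hpsi : forall t : padic_int p_pr,
       psi (t * p%:R) ≡
         psi 0 + \sum_(1 <= k < r) A k / (k`!)%:R * (t * p%:R) ^+ k
         [mod p%:R ^+ r])
    (a : nat -> padic_int p_pr)
    (ha : forall i j : nat, (1 <= i)%N -> (i < j)%N -> (j <= r)%N ->
       ~ (a i ≡ a j [mod p%:R]))
    (hzero : forall i : nat, (1 <= i <= r)%N ->
       psi (a i * p%:R) ≡ 0 [mod p%:R ^+ r]) :
  (forall s : padic_int p_pr, psi (s * p%:R) ≡ 0 [mod p%:R ^+ r]) /\
  (forall k : nat, (1 <= k <= r - 1)%N -> A k ≡ 0 [mod p%:R ^+ (r - k)]).
Proof.
case/andP: hr => r_gt0 le_rp; set P := p%:R : padic_int p_pr.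
(* The constant term is set apart: it is [psi 0], and [A 0] does not occur in the congruence for
   [psi]. *)
pose f : {poly padic_int p_pr} :=
  \poly_(k < r) (if k == 0%N then psi 0 else A k / (k`!)%:R * P ^+ k).
have psi_f t : psi (t * P) ≡ f.[t] [mod P ^+ r].
  have -> // : f.[t] = psi 0 + \sum_(1 <= k < r) A k / (k`!)%:R * (t * P) ^+ k.
  rewrite horner_poly -(big_mkord xpredT (fun k =>
    (if k == 0%N then psi 0 else A k / (k`!)%:R * P ^+ k) * t ^+ k)).
  rewrite big_ltn //= expr0 mulr1; congr (_ + _).
  by apply: eq_big_nat => -[|k] // _; rewrite exprMn mulrAC mulrA.
have f0 : forall k, f`_k ≡ 0 [mod P ^+ r].
  (* The points [a 1], ..., [a r] are reindexed from 0. Their differences are invertible mod [P],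
     hence mod [P ^+ r]. *)
  apply: (@congr_poly_coef0 _ _ r f (a \o succn)) => [i j /andP[ij jr]||i ir].
  - have [v va] : exists v, v * (a i.+1 - a j.+1) ≡ 1 [mod P].
      apply: padic_inv_mod_p => /(congr_mod_sub0 _ (a i.+1)).
      exact: (ha i.+1 j.+1).
    exact: congr_inv_exp va.
  - exact: size_poly.
  - by apply/(congr_mod0_eq (psi_f _)); apply: hzero.
split=> [s|k /andP[k_gt0]].
  apply/(congr_mod0_eq (psi_f s)); rewrite horner_coef.
  elim/big_ind: _ => [|x y|k _]; first by apply/congr_mod0P; exists 0; rewrite mul0r.
    exact: congr_mod0D.
  exact: congr_mod0Mr.
rewrite leq_subRL // add1n => lt_kr.
have /congr_mod0P[z] := f0 k.
rewrite coef_poly lt_kr eqn0Ngt k_gt0 /= => AkE.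
apply/congr_mod0P; exists (z * (k`!)%:R).
have kU : ((k`!)%:R : padic_int p_pr) \is a GRing.unit.
  by apply: padic_fact_unit; apply: leq_trans le_rp.
(* Splitting [P ^+ r] as [P ^+ (r - k) * P ^+ k] lets the factor [P ^+ k] be cancelled; multiplying
   by the unit [k!] then isolates [A k]. *)
have {AkE} : (A k / (k`!)%:R) * P ^+ k = (z * P ^+ (r - k)) * P ^+ k.
  by rewrite AkE -mulrA -exprD subnK // ltnW.
move=> /padic_mulIpexp /(congr1 ( *%R^~ (k`!)%:R)) /=.
by rewrite mulrVK // mulrAC.
Qed.
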